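(* Let $\Phi:\mathbb{R}\to[0,\infty)$ be a convex function, let $n\ge 1$, and let $A_k<0<B_k$ ($k=1,\dots,n$) be real numbers. Let $\phi=\{\phi_k: k=1,2,\dots,n\}$ be a system of real random variables on a probability space satisfying $A_k\le \phi_k\le B_k$ for all $k$. Then for every integer $l$ with $1\le l\le n$ there exist $\{A_k,B_k\}$-valued mean zero random variables $\xi_k$, $k=1,2,\dots,n$ (on some probability space), which are $\mathfrak{M}_l$-independent, such that for every choice of real coefficients $a_1,\dots,a_n$ $$\mathbf{E}\left[\Phi\left(\sum_{k=1}^n a_k\phi_k\right)\right]\le (1+\mu(\phi,\mathfrak{M}_l))\,\mathbf{E}\left[\Phi\left(\sum_{k=1}^n a_k\xi_k\right)\right].$$
   Context: $\mathbb{Z}_n=\{1,2,\dots,n\}$, and for $1\le l\le n$, $\mathfrak{M}_l$ denotes the family of all nonempty subsets of $\mathbb{Z}_n$ of cardinality at most $l$. For a family $\mathfrak{M}$ of nonempty subsets of $\mathbb{Z}_n$, random variables $\xi_1,\dots,\xi_n$ are called $\mathfrak{M}$-independent if for every $\{n_1,\dots,n_\nu\}\in\mathfrak{M}$ the variables $\xi_{n_1},\dots,\xi_{n_\nu}$ are stochastically independent. With $C_k=\min\{-A_k,B_k\}$, the multiplicative error of $\phi$ over $\mathfrak{M}$ is $$\mu(\phi,\mathfrak{M})=\sum_{\{n_1,\dots,n_\nu\}\in\mathfrak{M}}\frac{1}{C_{n_1}C_{n_2}\cdots C_{n_\nu}}\left|\mathbf{E}[\phi_{n_1}\phi_{n_2}\cdots\phi_{n_\nu}]\right|.$$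 *)

(* Defs.v *)
From HB Require Import structures.
From mathcomp Require Export all_boot all_order all_algebra.
From mathcomp Require Export all_classical all_reals all_analysis.
Export Order.TTheory GRing.Theory Num.Theory numFieldNormedType.Exports.

Set Implicit Arguments.
Unset Strict Implicit.
Unset Printing Implicit Defensive.

Local Open Scope ring_scope.
Local Open Scope ereal_scope.

(* The index set {1, ..., n} is represented by 'I_n. *)
Definition nonempty_subsets_le (n l : nat) : {set {set 'I_n}} :=
  [set J : {set 'I_n} | (0 < #|J| <= l)%N]%SET.

(* The product rule for subfamilies of J is included: take B k := setT for the
   indices left out. *)
Definition mutually_independent d (T : measurableType d) (R : realType)
    (P : probability T R) (n : nat) (X : 'I_n -> {RV P >-> R})
    (J : {set 'I_n}) : Prop :=
  forall B : 'I_n -> set R, (forall k, k \in J -> measurable (B k)) ->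
    P [set w : T | forall k, k \in J -> B k (X k w)]%classic =
      \prod_(k in J) P (X k @^-1` B k)%classic.

Arguments mutually_independent {d T R} P {n} X J.

Definition family_independent d (T : measurableType d) (R : realType)
    (P : probability T R) (n : nat) (M : {set {set 'I_n}})
    (X : 'I_n -> {RV P >-> R}) : Prop :=
  forall J, J \in M -> mutually_independent P X J.

Arguments family_independent {d T R} P {n} M X.

Definition multiplicative_error d (T : measurableType d) (R : realType)
    (P : probability T R) (n : nat) (A B : 'I_n -> R)
    (phi : 'I_n -> {RV P >-> R}) (M : {set {set 'I_n}}) : \bar R :=
  let C k := Num.min (- A k)%R (B k) in
  \sum_(J in M)
    ((\prod_(k in J) C k)^-1)%R%:E *
    `| 'E_P[fun w => (\prod_(k in J) phi k w)%R] |.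

Arguments multiplicative_error {d T R} P {n} A B phi M.

(* Main.v *)
Require Import Defs.
From HB Require Import structures.
From mathcomp Require Import ring lra.

(* Every point x of the box prod_k [A_k, B_k] is the barycenter of the product
   law Q_x on its vertices whose k-th factor has mean x_k, so by Jensen's
   inequality E[Phi(sum a_k phi_k)] is at most the integral of
   e |-> Phi(sum a_k e_k) against the law Q = E[Q_phi].  Let rho be the mean
   zero product law.  Relative to rho, Q has density
     1 + sum_{K nonempty} E[prod_{k in K} phi_k] r_K(e),
   where r_K is a product of functions r_k of the coordinates in K, each of
   rho-mean zero and bounded by 1 / C_k.  The terms with 1 <= #|K| <= l are
   together at most mu; replacing them by the constant mu and normalizing gives
     w = rho (1 + (1 + mu)^-1 sum_{#|K| > l} E[prod_{k in K} phi_k] r_K),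
   which satisfies 0 <= Q <= (1 + mu) w.  Since r_K integrates to zero over any
   coordinate of K, the marginals of w on at most l coordinates agree with those
   of rho, whence the coordinates are M_l-independent and centered under w. *)

Set Implicit Arguments.
Unset Strict Implicit.
Unset Printing Implicit Defensive.

Local Open Scope ring_scope.

(** * Jensen's inequality for finite weighted sums *)

Section Jensen.
Variables (R : realType) (Phi : R -> R).
Hypothesis Phi_convex : convex_function (E := R^o) [set: R^o]%classic Phi.

Lemma convex_weighted2 (p q x y : R) : 0 < p -> 0 <= q ->
  (p + q) * Phi ((p * x + q * y) / (p + q)) <= p * Phi x + q * Phi y.
Proof.
move=> p0 q0; have pq0 : 0 < p + q by rewrite ltr_pwDl.
have t01 : 0 <= p / (p + q) <= 1.
  by rewrite divr_ge0 ?(ltW p0) ?(ltW pq0)//= ler_pdivrMr// mul1r lerDl.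
have h : Phi (p / (p + q) * x + (1 - p / (p + q)) * y) <=
    p / (p + q) * Phi x + (1 - p / (p + q)) * Phi y.
  by apply: (@Phi_convex (Itv01 (proj1 (andP t01)) (proj2 (andP t01))) x y);
    rewrite !inE.
have -> : (p * x + q * y) / (p + q) =
  p / (p + q) * x + (1 - p / (p + q)) * y by field; rewrite gt_eqF.
rewrite -ler_pdivlMl//; apply: (le_trans h).
by rewrite le_eqVlt; apply/orP; left; apply/eqP; field; rewrite gt_eqF.
Qed.

(** Induction on [s]: the head point is merged with [y] into their barycenter, of weight [p + w i].
    Keeping [p] positive makes every denominator nonzero. *)
Lemma convex_weighted_sum (I : Type) (s : seq I) (w x : I -> R) (p y : R) :
  0 < p -> (forall i, 0 <= w i) ->
  (p + \sum_(i <- s) w i) *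
    Phi ((p * y + \sum_(i <- s) w i * x i) / (p + \sum_(i <- s) w i)) <=
  p * Phi y + \sum_(i <- s) w i * Phi (x i).
Proof.
move=> p0 w0; elim: s p y p0 => [|i s IH] p y p0.
  by rewrite !big_nil !addr0 mulrAC divff ?mul1r// gt_eqF.
rewrite !big_cons !addrA.
have pi0 : 0 < p + w i by rewrite ltr_pwDl.
have := IH (p + w i) ((p * y + w i * x i) / (p + w i)) pi0.
rewrite [X in X + \sum_(j <- s) w j * x j]mulrC divfK ?gt_eqF// => /le_trans.
by apply; rewrite lerD2r convex_weighted2.
Qed.

(* Adding the barycenter itself as a further point of weight 1 avoids
   dividing by a possibly vanishing partial sum of the weights. *)
Lemma convex_jensen (I : finType) (w x : I -> R) :
  (forall i, 0 <= w i) -> \sum_i w i = 1 ->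
  Phi (\sum_i w i * x i) <= \sum_i w i * Phi (x i).
Proof.
move=> w0 w1; set z := \sum_i w i * x i.
have := convex_weighted_sum (index_enum I) x z ltr01 w0.
rewrite w1 !mul1r -/z (_ : (z + z) / (1 + 1) = z); last by field.
by rewrite mulrDl mul1r lerD2l.
Qed.

End Jensen.

(** * Product laws on the vertices and their expansion over index subsets *)

Section TwoPoint.
Variables (R : realType) (n : nat) (A B : 'I_n -> R).
Hypothesis AB : forall k, A k < 0 < B k.

Definition endpoint (k : 'I_n) (b : bool) : R := if b then B k else A k.

(* The k-th marginal of the law rho; the functions r_k are called slope below
   and the law Q_x kernel x. *)
Definition balance (k : 'I_n) (b : bool) : R :=
  endpoint k (~~ b) / (endpoint k (~~ b) - endpoint k b).

Definition slope (k : 'I_n) (b : bool) : R := - (endpoint k (~~ b))^-1.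

Let A0 k : A k < 0. Proof. by case/andP: (AB k). Qed.
Let B0 k : 0 < B k. Proof. by case/andP: (AB k). Qed.
Let ABne k : A k - B k != 0.
Proof. by rewrite subr_eq0 lt_eqF// (lt_trans (A0 k)). Qed.
Let BAne k : B k - A k != 0.
Proof. by rewrite -oppr_eq0 opprB ABne. Qed.
Let Ane k : A k != 0. Proof. by rewrite lt_eqF. Qed.
Let Bne k : B k != 0. Proof. by rewrite gt_eqF. Qed.

Lemma balance_ge0 k b : 0 <= balance k b.
Proof.
have := A0 k; have := B0 k; rewrite /balance; case: b => /= Bp An.
  by rewrite -mulrNN -invrN divr_ge0//; lra.
by rewrite divr_ge0//; lra.
Qed.

Lemma balance_sum k : \sum_b balance k b = 1.
Proof. by rewrite big_bool /balance/=; field; rewrite ABne BAne. Qed.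

Lemma balance_endpoint k : \sum_b balance k b * endpoint k b = 0.
Proof. by rewrite big_bool /balance/=; field; rewrite ABne BAne. Qed.

Lemma balance_slope k : \sum_b balance k b * slope k b = 0.
Proof.
rewrite big_bool /balance /slope/=; field.
by rewrite ABne BAne Ane Bne.
Qed.

Lemma slope_le k b : `|slope k b| <= (Num.min (- A k) (B k))^-1.
Proof.
have Ak := A0 k; have Bk := B0 k.
have C0 : 0 < Num.min (- A k) (B k) by rewrite lt_min oppr_gt0 Ak.
rewrite normrN normfV lef_pV2 ?posrE ?normr_gt0//.
  by case: b => /=; rewrite ge_min ?(ltr0_norm Ak) ?(gtr0_norm Bk) lexx ?orbT.
by case: b => /=; rewrite ?Ane ?Bne.
Qed.

Definition kernel (x : 'I_n -> R) (e : {ffun 'I_n -> bool}) : R :=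
  \prod_k (balance k (e k) * (1 + x k * slope k (e k))).

(** These factors are the barycentric coordinates of [x k] between the two endpoints, which makes
    their sign visible. *)
Let step x k b : A k <= x k <= B k ->
  balance k b * (1 + x k * slope k b) =
  (endpoint k (~~ b) - x k) / (endpoint k (~~ b) - endpoint k b).
Proof.
have := A0 k; have := B0 k; rewrite /balance /slope; case: b => /= ? ? _; field.
  by rewrite ABne Ane.
by rewrite BAne Bne.
Qed.

Lemma kernel_ge0 x e : (forall k, A k <= x k <= B k) -> 0 <= kernel x e.
Proof.
move=> xAB; apply: prodr_ge0 => k _; rewrite step//.
have /andP[Ax xB] := xAB k; have := A0 k; have := B0 k.
case: (e k) => /= Bp An; last by rewrite divr_ge0; lra.
by rewrite -mulrNN -invrN divr_ge0//; lra.
Qed.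

Lemma sum_prod_ffun (g : 'I_n -> bool -> R) :
  \sum_(e : {ffun 'I_n -> bool}) \prod_k g k (e k) = \prod_k \sum_b g k b.
Proof. by rewrite bigA_distr_bigA. Qed.

Let kernel_sum1 k (x : R) : \sum_b balance k b * (1 + x * slope k b) = 1.
Proof.
under eq_bigr do rewrite mulrDr mulr1 mulrCA.
by rewrite big_split/= -mulr_sumr balance_slope mulr0 addr0 balance_sum.
Qed.

Lemma kernel_sum x : \sum_e kernel x e = 1.
Proof.
rewrite (sum_prod_ffun (fun k b => balance k b * (1 + x k * slope k b))).
by rewrite big1.
Qed.

Lemma kernel_mean x k : \sum_e kernel x e * endpoint k (e k) = x k.
Proof.
(* Absorbing the endpoint into the factor of [k] alone keeps a pure product, so the sum over
   vertices factorizes. *)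
pose g j b := balance j b * (1 + x j * slope j b) *
  (if j == k then endpoint j b else 1).
transitivity (\sum_(e : {ffun 'I_n -> bool}) \prod_j g j (e j)).
  apply: eq_bigr => e _; rewrite big_split/=; congr (_ * _).
  by rewrite (bigD1 k)//= eqxx big1 ?mulr1// => j /negbTE ->.
rewrite sum_prod_ffun (bigD1 k)//= [X in _ * X]big1 ?mulr1; last first.
  move=> j /negbTE jk; rewrite -[RHS](kernel_sum1 j (x j)).
  by apply: eq_bigr => b _; rewrite /g jk mulr1.
rewrite big_bool /g eqxx /balance /slope/=.
field.
by rewrite ABne BAne Ane Bne.
Qed.

(** The formula is linear in [m]: the monomials of a point [x] give [kernel x], and the moments of
    the random variables give the averaged law Q. *)
Definition mixture (m : {set 'I_n} -> R) (e : {ffun 'I_n -> bool}) : R :=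
  \prod_k balance k (e k) *
  \sum_(K : {set 'I_n}) m K * \prod_(k in K) slope k (e k).

Lemma kernel_expand x e : kernel x e = mixture (fun K => \prod_(k in K) x k) e.
Proof.
rewrite /kernel /mixture big_split/=; congr (_ * _).
under eq_bigr do rewrite addrC.
rewrite bigA_distr; apply: eq_bigr => K _.
by rewrite -big_mkcond -big_split.
Qed.

(** The constant 1 stands in for all terms with [#|K| <= l]. For general [m] the values may be
    negative. *)
Definition weight (l : nat) (m : {set 'I_n} -> R) (e : {ffun 'I_n -> bool}) : R :=
  \prod_k balance k (e k) *
  (1 + \sum_(K : {set 'I_n} | (l < #|K|)%N) m K * \prod_(k in K) slope k (e k)).

(* A set of more than l indices has an element outside J; the factor of that
   index has mean zero. *)
Lemma weight_marginal l m (J : {set 'I_n}) (h : 'I_n -> bool -> R) :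
  (#|J| <= l)%N -> (forall k b, k \notin J -> h k b = 1) ->
  \sum_e weight l m e * \prod_k h k (e k) =
  \prod_(k in J) \sum_b balance k b * h k b.
Proof.
move=> Jl h1.
have -> : \prod_(k in J) \sum_b balance k b * h k b =
    \prod_k \sum_b balance k b * h k b.
  rewrite big_mkcond/=; apply: eq_bigr => k _; case: ifPn => // kJ.
  by under eq_bigr do rewrite h1// mulr1; rewrite balance_sum.
rewrite -(sum_prod_ffun (fun k b => balance k b * h k b)).
have high0 : \sum_(K : {set 'I_n} | (l < #|K|)%N) m K *
   \sum_(e : {ffun 'I_n -> bool}) \prod_k (balance k (e k) * h k (e k) *
     (if k \in K then slope k (e k) else 1)) = 0.
  rewrite big1// => K lK.
  rewrite (sum_prod_ffun (fun k b => balance k b * h k b *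
     (if k \in K then slope k b else 1))).
  have /subsetPn[k kK kJ] : ~~ (K \subset J).
    by apply/negP => /subset_leq_card /leq_trans /(_ Jl); rewrite leqNgt lK.
  rewrite (bigD1 k)//= kK.
  under eq_bigr do rewrite h1// mulr1.
  by rewrite balance_slope mul0r mulr0.
rewrite -[RHS]addr0 -[X in _ = _ + X]high0.
under [X in _ = _ + X]eq_bigr do rewrite mulr_sumr.
rewrite exchange_big -big_split/=; apply: eq_bigr => e _.
rewrite /weight mulrAC mulrDr mulr1 -big_split/= mulr_sumr; congr (_ + _).
by apply: eq_bigr => K _; rewrite mulrCA [in RHS]big_split/= -big_mkcond.
Qed.

Lemma weight_sum l m : \sum_e weight l m e = 1.
Proof.
have := @weight_marginal l m finset.set0 (fun _ _ => 1).
rewrite cards0 big_set0 => <- //.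
by apply: eq_bigr => e _; rewrite big1 ?mulr1.
Qed.

Lemma weight_mean l m k : (0 < l)%N ->
  \sum_e weight l m e * endpoint k (e k) = 0.
Proof.
move=> l0.
have := @weight_marginal l m [set k]%SET
  (fun j b => if j == k then endpoint j b else 1).
rewrite cards1 big_set1 => /(_ l0) H.
transitivity (\sum_b balance k b * (if k == k then endpoint k b else 1)).
  rewrite -H => [|j b]; last by rewrite inE => /negbTE ->.
  apply: eq_bigr => e _; congr (_ * _).
  by rewrite (bigD1 k)//= eqxx big1 ?mulr1// => j /negbTE ->.
by under eq_bigr do rewrite eqxx; rewrite balance_endpoint.
Qed.

(** * Domination of the mixture by the normalized weight *)

Section Domination.
Variables (l : nat) (m : {set 'I_n} -> R).
Hypothesis m0 : m finset.set0 = 1.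

Definition real_error : R := \sum_(K in nonempty_subsets_le n l)
  (\prod_(k in K) Num.min (- A k) (B k))^-1 * `|m K|.

Lemma real_error_ge0 : 0 <= real_error.
Proof.
apply: sumr_ge0 => K _; rewrite mulr_ge0// invr_ge0 prodr_ge0// => k _.
by rewrite le_min oppr_ge0 !ltW.
Qed.

Let low (e : {ffun 'I_n -> bool}) : R :=
  \sum_(K in nonempty_subsets_le n l) m K * \prod_(k in K) slope k (e k).

Let high (e : {ffun 'I_n -> bool}) : R :=
  \sum_(K : {set 'I_n} | (l < #|K|)%N) m K * \prod_(k in K) slope k (e k).

Let low_le (e : {ffun 'I_n -> bool}) : low e <= real_error.
Proof.
apply: ler_sum => K _; apply: (le_trans (ler_norm _)).
rewrite normrM mulrC ler_wpM2r// normr_prod -prodfV ler_prod// => k _.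
by rewrite normr_ge0 slope_le.
Qed.

Let full_split (e : {ffun 'I_n -> bool}) :
  \sum_(K : {set 'I_n}) m K * \prod_(k in K) slope k (e k) = 1 + low e + high e.
Proof.
rewrite (bigD1 finset.set0)//= m0 big_set0 mulr1 -addrA; congr (_ + _).
rewrite (bigID (fun K : {set 'I_n} => #|K| <= l)%N)/=; congr (_ + _).
  by apply: eq_bigl => K; rewrite inE card_gt0.
apply: eq_bigl => K; rewrite -ltnNge; case: eqVneq => //= ->.
by rewrite cards0.
Qed.

Let balance_prod_ge0 (e : {ffun 'I_n -> bool}) : 0 <= \prod_k balance k (e k).
Proof. by apply: prodr_ge0 => k _; exact: balance_ge0. Qed.

(** Dividing only the coefficients by [1 + real_error], and not the constant term, keeps the total
    mass equal to 1. *)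
Definition normalized_weight := weight l (fun K => m K / (1 + real_error)).

Let mu1 : 0 < 1 + real_error.
Proof. by rewrite ltr_pwDl// real_error_ge0. Qed.

Lemma normalized_weightE e : (1 + real_error) * normalized_weight e =
  \prod_k balance k (e k) * (1 + real_error + high e).
Proof.
rewrite /normalized_weight /weight mulrCA mulrDr mulr1 mulr_sumr.
congr (_ * (_ + _)); apply: eq_bigr => K _.
by rewrite mulrA [m K / _]mulrC mulrA divff ?mul1r// gt_eqF.
Qed.

(** Both sides share the terms with [l < #|K|]; what remains is [1 + low e <= 1 + real_error]. *)
Lemma mixture_le_weight (e : {ffun 'I_n -> bool}) :
  mixture m e <= (1 + real_error) * normalized_weight e.
Proof.
by rewrite normalized_weightE /mixture full_split ler_wpM2l// !lerD2r lerD2l low_le.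
Qed.

(** The weight has no evident sign; it inherits positivity from the mixture that it dominates. *)
Lemma normalized_weight_ge0 (e : {ffun 'I_n -> bool}) :
  0 <= mixture m e -> 0 <= normalized_weight e.
Proof.
by move=> /le_trans /(_ (mixture_le_weight e)); rewrite pmulr_rge0.
Qed.

End Domination.

End TwoPoint.

(** * Probability measures on the finite space of sign vectors *)

Definition signs (n : nat) := {ffun 'I_n -> bool}.

HB.instance Definition _ n := Finite.on (signs n).
HB.instance Definition _ n := isPointed.Build (signs n) [ffun=> false].
HB.instance Definition _ n := @isMeasurable.Build default_measure_display
  (signs n) discrete_measurable discrete_measurable0
  discrete_measurableC discrete_measurableU.

Section FiniteProbability.
Variables (R : realType) (n : nat) (w : signs n -> R).
Hypothesis w0 : forall e, 0 <= w e.
Hypothesis w1 : \sum_e w e = 1.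

(** The default [point] is never reached in [finprob], which only sums indices below the
    cardinality. *)
Definition atom (i : nat) : signs n := nth point (enum {: signs n}) i.

(* The argument w1 is not used in the body, but from it the probability
   structure below is inferred. *)
Definition finprob (_ : \sum_e w e = 1) : set (signs n) -> \bar R :=
  msum (fun i => mscale (NngNum (w0 (atom i))) (dirac (atom i))) #|{: signs n}|.

Local Notation P := (finprob w1).

HB.instance Definition _ := Measure.on P.

Let sum_atom (f : signs n -> R) :
  \sum_(i < #|{: signs n}|) f (atom i) = \sum_e f e.
Proof. by rewrite -[RHS]big_enum/= (big_nth point) big_mkord -cardE. Qed.

Lemma finprobE (D : set (signs n)) :
  P D = (\sum_e w e * \1_D e)%:E.
Proof.
rewrite /finprob /msum -sum_atom -sumEFin; apply: eq_bigr => i _.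
by rewrite EFinM indicE -(diracE R).
Qed.

Let finprob_setT : P setT = 1%E.
Proof.
by rewrite finprobE; under eq_bigr do rewrite indicT mulr1; rewrite w1.
Qed.

HB.instance Definition _ := Measure_isProbability.Build _ _ _ P finprob_setT.

Lemma measurable_signs (f : signs n -> R) : measurable_fun setT f.
Proof. by []. Qed.

Lemma ge0_integral_finprob (f : signs n -> R) : (forall e, 0 <= f e) ->
  (\int[P]_e (f e)%:E)%E = (\sum_e w e * f e)%:E.
Proof.
move=> f0; rewrite ge0_integral_measure_sum//; last first.
  by move=> e _; rewrite lee_fin.
rewrite -sum_atom -sumEFin; apply: eq_bigr => i _.
rewrite ge0_integral_mscale//; last by move=> e _; rewrite lee_fin.
by rewrite integral_dirac// diracT mul1e EFinM.
Qed.

Lemma expectation_finprob (f : signs n -> R) :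
  'E_P[f]%E = (\sum_e w e * f e)%:E.
Proof.
have funepos_fin e : (((EFin \o f)^\+) e)%E = (Num.max (f e) 0)%:E.
  by rewrite funeposE EFin_max.
have funeneg_fin e : (((EFin \o f)^\-) e)%E = (Num.max (- f e) 0)%:E.
  by rewrite funenegE EFin_max.
rewrite unlock integralE.
under eq_integral do rewrite funepos_fin.
under [X in (_ - X)%E]eq_integral do rewrite funeneg_fin.
rewrite !ge0_integral_finprob => [|e|e]; rewrite ?le_max ?lexx ?orbT//.
rewrite -EFinB -sumrB; congr EFin; apply: eq_bigr => e _; rewrite -mulrBr.
congr (_ * _); case: (leP 0 (f e)) => fe; case: (leP 0 (- f e)) => fe'; lra.
Qed.

End FiniteProbability.

(** * Monotonicity of the integral and integrability of bounded products *)

Section Integration.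
Context d (T : measurableType d) (R : realType).

(* Unlike ge0_le_integral, no measurability is required. *)
Lemma ge0_le_integralT (mu : {measure set T -> \bar R}) (f g : T -> \bar R) :
  (forall x, 0 <= f x)%E -> (forall x, f x <= g x)%E ->
  (\int[mu]_x f x <= \int[mu]_x g x)%E.
Proof.
move=> f0 fg; rewrite !ge0_integralTE// => [|x]; last exact: le_trans (fg x).
by apply: le_ereal_sup => _ [h hf <-]; exists h => // x; exact: le_trans (fg x).
Qed.

Lemma integrable_prod (P : probability T R) n (phi : 'I_n -> {RV P >-> R})
    (A B : 'I_n -> R) (K : {set 'I_n}) : (forall k w, A k <= phi k w <= B k) ->
  P.-integrable setT (EFin \o fun w => \prod_(k in K) phi k w).
Proof.
move=> phiAB; apply: measurable_bounded_integrable => //.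
- exact: (le_lt_trans (probability_le1 P measurableT) (ltry 1)).
- under eq_fun do rewrite -big_enum/=.
  exact: measurable_prod.
- exists (\prod_(k in K) Num.max `|A k| `|B k|); split; first exact: num_real.
  move=> M ltM w _; apply: le_trans (ltW ltM).
  rewrite normr_prod; apply: ler_prod => k _; rewrite normr_ge0/=.
  have /andP[Ap pB] := phiAB k w.
  by rewrite le_max; case: (ger0P (phi k w)) => ph; apply/orP; [right|left];
    [rewrite ger0_norm//; lra|rewrite ler0_norm; lra].
Qed.

End Integration.

(** * Moments and the averaged kernel *)

Section Moments.
Context d (T : measurableType d) (R : realType) (P : probability T R).
Variables (n : nat) (A B : 'I_n -> R) (phi : 'I_n -> {RV P >-> R}).
Hypothesis AB : forall k, A k < 0 < B k.
Hypothesis phi_AB : forall k w, A k <= phi k w <= B k.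

Definition moment (K : {set 'I_n}) : R :=
  fine 'E_P[fun w => (\prod_(k in K) phi k w)%R]%E.

Lemma momentE (K : {set 'I_n}) :
  'E_P[fun w => (\prod_(k in K) phi k w)%R]%E = (moment K)%:E.
Proof.
rewrite /moment fineK// unlock integrable_fin_num//.
exact: (integrable_prod K phi_AB).
Qed.

Lemma moment0 : moment finset.set0 = 1.
Proof.
rewrite /moment; under [X in 'E_P[X]%E]eq_fun do rewrite big_set0.
by rewrite expectation_cst.
Qed.

Lemma multiplicative_errorE l :
  multiplicative_error P A B phi (nonempty_subsets_le n l) =
  (real_error A B l moment)%:E.
Proof.
rewrite /multiplicative_error /real_error -sumEFin; apply: eq_bigr => K _.
by rewrite momentE EFinM.
Qed.

(** At a fixed vertex the kernel is a linear combination of monomials in [phi], so integrating it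
    reduces to moments. *)
Let kernel_EFin (e : {ffun 'I_n -> bool}) :
  (fun w => (kernel A B (phi ^~ w) e)%:E) =
  (fun w => \sum_(K : {set 'I_n})
     (\prod_k balance A B k (e k) * \prod_(k in K) slope A B k (e k))%:E *
     (\prod_(k in K) phi k w)%:E)%E.
Proof.
apply/funext => w; rewrite kernel_expand// /mixture mulr_sumr -sumEFin.
by apply: eq_bigr => K _; rewrite -EFinM mulrA mulrAC.
Qed.

Lemma integrable_kernel e :
  P.-integrable setT (fun w => (kernel A B (phi ^~ w) e)%:E).
Proof.
rewrite kernel_EFin; apply: integrable_sum => // K _.
by apply: integrableZl => //; exact: (integrable_prod K phi_AB).
Qed.

Lemma integral_kernel e :
  (\int[P]_w (kernel A B (phi ^~ w) e)%:E)%E = (mixture A B moment e)%:E.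
Proof.
rewrite kernel_EFin integral_sum//; last first.
  move=> K; apply: integrableZl => //; exact: (integrable_prod K phi_AB).
rewrite /mixture mulr_sumr -sumEFin; apply: eq_bigr => K _.
rewrite integralZl//; last exact: (integrable_prod K phi_AB).
have := momentE K; rewrite unlock => ->.
by rewrite -EFinM mulrAC -mulrA.
Qed.

(** The sign cannot be read off the expansion; it comes from the integral of a nonnegative
    kernel. *)
Lemma mixture_ge0 e : 0 <= mixture A B moment e.
Proof.
rewrite -lee_fin -integral_kernel; apply: integral_ge0 => w _.
by rewrite lee_fin kernel_ge0.
Qed.

Lemma expectation_convex_le (Phi : R -> R) (a : 'I_n -> R) :
  (forall x, 0 <= Phi x) ->
  convex_function (E := R^o) [set: R^o]%classic Phi ->
  ('E_P[fun w => Phi (\sum_(k < n) a k * phi k w)%R] <=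
   (\sum_(e : {ffun 'I_n -> bool})
     Phi (\sum_(k < n) a k * endpoint A B k (e k)) * mixture A B moment e)%:E)%E.
Proof.
move=> Phi0 cPhi.
pose v (e : {ffun 'I_n -> bool}) := \sum_(k < n) a k * endpoint A B k (e k).
rewrite unlock.
(* Jensen's inequality is applied pointwise in [w]; the resulting finite sum is then integrated term
   by term. *)
apply: (@le_trans _ _ (\int[P]_w \sum_(e : {ffun 'I_n -> bool})
    (Phi (v e))%:E * (kernel A B (phi ^~ w) e)%:E)%E).
  apply: ge0_le_integralT => w; rewrite ?lee_fin//.
  under [leRHS]eq_bigr do rewrite -EFinM mulrC; rewrite sumEFin lee_fin.
  have -> : \sum_(k < n) a k * phi k w = \sum_e kernel A B (phi ^~ w) e * v e.
    under [RHS]eq_bigr do rewrite mulr_sumr.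
    rewrite exchange_big/=; apply: eq_bigr => k _.
    rewrite -[X in a k * X](kernel_mean AB (phi ^~ w) k) mulr_sumr.
    by apply: eq_bigr => e _; rewrite mulrCA.
  apply: convex_jensen => // [e|]; [exact: kernel_ge0|exact: kernel_sum].
rewrite integral_sum//; last first.
  by move=> e; apply: integrableZl => //; exact: integrable_kernel.
rewrite -sumEFin; apply: lee_sum => e _.
rewrite integralZl//; last exact: integrable_kernel.
by rewrite integral_kernel -EFinM.
Qed.

End Moments.

(** * Construction of the two-valued variables and their properties *)

Theorem theorem1p1 (R : realType) (Phi : R -> R)
    (Phi_ge0 : forall x : R, 0 <= Phi x)
    (Phi_convex : convex_function (E := R^o) [set: R^o]%classic Phi)
    (n : nat) (n_gt0 : (1 <= n)%N)
    (A B : 'I_n -> R) (AB : forall k, A k < 0 < B k)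
    (d : measure_display) (T : measurableType d) (P : probability T R)
    (phi : 'I_n -> {RV P >-> R})
    (phi_AB : forall k w, A k <= phi k w <= B k)
    (l : nat) (l_range : (1 <= l <= n)%N) :
  exists (d' : measure_display) (T' : measurableType d')
      (P' : probability T' R) (xi : 'I_n -> {RV P' >-> R}),
    [/\ forall k w, xi k w = A k \/ xi k w = B k,
        forall k, ('E_P'[xi k] = 0)%E,
        family_independent P' (nonempty_subsets_le n l) xi &
        forall a : 'I_n -> R,
          ('E_P[fun w => Phi (\sum_(k < n) a k * phi k w)%R] <=
           (1 + multiplicative_error P A B phi (nonempty_subsets_le n l)) *
           'E_P'[fun w => Phi (\sum_(k < n) a k * xi k w)%R])%E].
Proof.
have /andP[l_gt0 _] := l_range.
pose m := moment phi; pose mu := real_error A B l m.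
pose w : signs n -> R := normalized_weight A B l m.
have m0 : m finset.set0 = 1 by exact: moment0.
have w0 e : 0 <= w e.
  by apply: normalized_weight_ge0 => //; exact: mixture_ge0.
have w1 : \sum_e w e = 1 by exact: weight_sum.
pose P' : probability (signs n) R := finprob w0 w1.
pose coord k (e : signs n) : R := endpoint A B k (e k).
pose xi k : {RV P' >-> R} :=
  HB.pack (coord k) (@isMeasurableFun.Build _ _ _ _ (coord k)
    (measurable_signs (coord k))).
exists default_measure_display, (signs n), P', xi; split.
- by move=> k e; rewrite /= /coord /endpoint; case: (e k); [right|left].
- by move=> k; rewrite expectation_finprob weight_mean.
- move=> J; rewrite inE => /andP[_ Jl] C _.
  (* Events whose indicator is a product over coordinates; this serves both the joint event on [J]
     and each single coordinate. *)
  have probE (h : 'I_n -> bool -> R) (D : set (signs n))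
      (K : {set 'I_n}) : (#|K| <= l)%N ->
      (forall k b, k \notin K -> h k b = 1) ->
      (forall e, \1_D e = \prod_k h k (e k)) ->
      P' D = (\prod_(k in K) \sum_b balance A B k b * h k b)%:E.
    move=> Kl h1 hD; rewrite [LHS](finprobE w0 w1); congr EFin.
    rewrite -(weight_marginal AB (fun K => m K / (1 + mu)) Kl h1).
    by apply: eq_bigr => e _; rewrite hD.
  pose h (K : {set 'I_n}) k b : R :=
    if k \in K then \1_(C k) (endpoint A B k b) else 1.
  have hE (K : {set 'I_n}) (e : signs n) :
      \1_[set e : signs n | forall k, k \in K -> C k (xi k e)]%classic e =
      \prod_k h K k (e k).
    rewrite -big_mkcond/= indicE; case: (boolP (e \in _)).
      rewrite inE => /= Ce; rewrite big1// => k kK.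
      by rewrite indicE mem_set//; exact: Ce.
    rewrite notin_setE/= => /existsNP[k /not_implyP[kK nC]].
    by rewrite (bigD1 k)//= indicE memNset// mul0r.
  have hK (K : {set 'I_n}) k b : k \notin K -> h K k b = 1.
    by rewrite /h => /negbTE ->.
  rewrite (probE (h J) _ J Jl (hK J) (hE J)) -prodEFin.
  apply: eq_bigr => k kJ.
  (* The preimage is written as the joint event of a singleton, so that [probE] applies to it as
     well; its size is at most [l] because [l] is positive. *)
  have -> : (xi k @^-1` C k =
      [set e : signs n | forall j, j \in [set k]%SET -> C j (xi j e)])%classic.
    apply/seteqP; split=> e /=; last by apply; rewrite inE.
    by move=> Ce j; rewrite inE => /eqP ->.
  have k1 : (#|[set k]%SET| <= l)%N by rewrite cards1.
  rewrite (probE (h [set k]%SET) _ [set k]%SET k1 (hK _) (hE _)) big_set1.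
  by congr EFin; apply: eq_bigr => b _; rewrite /h kJ inE eqxx.
- move=> a.
  apply: (le_trans (expectation_convex_le AB phi_AB a Phi_ge0 Phi_convex)).
  rewrite multiplicative_errorE// expectation_finprob -EFinD -EFinM lee_fin.
  (* Comparing vertex by vertex suffices, because [Phi] is nonnegative and the weights dominate the
     mixture. *)
  rewrite mulr_sumr; apply: ler_sum => e _.
  by rewrite [leRHS]mulrA [leRHS]mulrC ler_wpM2l//; exact: mixture_le_weight.
Qed.
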